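(* Let $M$ be an infinite compact subset of a strictly convex Banach space $X$, with the metric induced by the norm and with a distinguished point $0_M\in M$. Then $\mathrm{Lip}_0(M)$ has the Daugavet property if and only if $M$ is convex.
   Context: All Banach spaces are real. $\mathrm{Lip}_0(M)$ is the Banach space of all Lipschitz functions $f\colon M\to\mathbb R$ vanishing at the distinguished point of $M$, normed by the Lipschitz constant. A Banach space $Z$ has the Daugavet property if every bounded rank-one operator $T\colon Z\to Z$ satisfies $\|T+I\|=1+\|T\|$, where $I$ is the identity. $X$ is strictly convex (rotund) if its unit sphere contains no non-trivial segment. *)

(* Defs.v *)
From HB Require Import structures.
From mathcomp Require Import all_boot all_order all_algebra.
From mathcomp Require Import all_classical all_reals all_analysis.

Set Implicit Arguments.
Unset Strict Implicit.
Unset Printing Implicit Defensive.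

Import Order.TTheory GRing.Theory Num.Theory.
Import numFieldNormedType.Exports.

Local Open Scope classical_set_scope.
Local Open Scope ring_scope.

Section operators.
Context {R : realType} {Z W : normedModType R}.

(* [sup] is total (0 on an unbounded set), so this is the operator norm only
   for bounded operators. *)
Definition opnorm (T : Z -> W) : R :=
  sup [set `|T z| | z in [set z : Z | `|z| <= 1]].

Definition rank_one (T : Z -> W) : Prop :=
  exists2 w : W, w != 0 & range T = range (fun a : R => a *: w).

End operators.

Definition daugavet_property {R : realType} (Z : normedModType R) : Prop :=
  forall T : {linear Z -> Z}, bounded_near T (nbhs (0 : Z)) -> rank_one T ->
    opnorm (fun z => T z + z) = 1 + opnorm T.

Definition strictly_convex {R : realType} (X : normedModType R) : Prop :=
  forall x y : X,
    (forall t : R, 0 <= t <= 1 -> `|(1 - t) *: x + t *: y| = 1) -> x = y.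

(* The metric induced by the norm on a subset [M] of [X], seen as the type of
   its elements; it extends the library's pseudometric on [set_type M]. *)
Section subset_metric.
Context {R : realType} {X : normedModType R} (M : set X).

Let dist (x y : M) : R := `|val x - val y|.

Let dist_ge0 x y : 0 <= dist x y.
Proof. exact: normr_ge0. Qed.

Let dist_positivity x y : dist x y = 0 -> x = y.
Proof. by move=> /normr0_eq0/subr0_eq/val_inj. Qed.

Let ballEdist x d : ball x d = [set y | dist x y < d].
Proof.
rewrite [LHS](_ : _ = [set y : M | ball (val x) d (val y)]) //.
by rewrite -ball_normE.
Qed.

HB.instance Definition _ := @PseudoMetric_isMetric.Build R M dist
  dist_ge0 dist_positivity ballEdist.

End subset_metric.

Section lip0_def.
Context {R : realType} {T : metricType R} (p : T).

Definition lip0_pred : {pred T -> R} := mem [set f : T -> R | f p = 0 /\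
  exists k : R, forall x y, `|f x - f y| <= k * mdist x y].

Record lip0 := Lip0 { lip0_fun :> T -> R; _ : lip0_fun \in lip0_pred }.

HB.instance Definition _ := [isSub of lip0 for lip0_fun].
HB.instance Definition _ := [Choice of lip0 by <:].

Lemma lip0_submod_closed : submod_closed lip0_pred.
Proof.
split=> [|a f g]; rewrite !inE.
  by split=> //; exists 0 => x y; rewrite subrr normr0 mul0r.
move=> [f0 [k fk]] [g0 [l gl]]; split.
  by rewrite /GRing.add /GRing.scale/= f0 g0 scaler0 addr0.
exists (`|a| * k + l) => x y.
rewrite [X in `|X|](_ : _ = a * (f x - f y) + (g x - g y)); last first.
  by rewrite mulrBr opprD addrACA.
by rewrite (le_trans (ler_normD _ _))// mulrDl lerD// normrM -mulrA ler_wpM2l.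
Qed.

HB.instance Definition _ := GRing.isSubmodClosed.Build R (T -> R) lip0_pred
  lip0_submod_closed.
HB.instance Definition _ := [SubChoice_isSubLmodule of lip0 by <:].

End lip0_def.

Section lip0_norm.
Context {R : realType} {T : metricType R} {p : T}.
Implicit Types f g : lip0 p.

Definition slopes f : set R :=
  [set `|f z.1 - f z.2| / mdist z.1 z.2 | z in [set z : T * T | z.1 != z.2]].

(* When [T] is a single point this is [sup set0 = 0]. *)
Definition lipnorm f : R := sup (slopes f).

Lemma lip0_base f : f p = 0.
Proof. by case: f => f /=; rewrite inE => -[]. Qed.

Lemma lip0_lipschitz f : exists k : R, forall x y, `|f x - f y| <= k * mdist x y.
Proof. by case: f => f /=; rewrite inE => -[]. Qed.

Lemma lip0_eqP f g : f =1 g -> f = g.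
Proof. by move=> fg; exact/val_inj/funext. Qed.

Lemma lip0_addE f g x : (f + g) x = f x + g x. Proof. by []. Qed.
Lemma lip0_oppE f x : (- f) x = - f x. Proof. by []. Qed.
Lemma lip0_scaleE (a : R) f x : (a *: f) x = a * f x. Proof. by []. Qed.

Lemma slopes_has_ubound f : has_ubound (slopes f).
Proof.
have [k fk] := lip0_lipschitz f; exists k => _ [[x y] /= xy <-].
by rewrite ler_pdivrMr ?mdist_gt0.
Qed.

Lemma lipnorm_ge0 f : 0 <= lipnorm f.
Proof.
have [s0|/set0P[v [z z12 zv]]] := eqVneq (slopes f) set0.
  by rewrite /lipnorm s0 sup0.
apply: le_trans (ub_le_sup (slopes_has_ubound f) _); last by exists z.
by rewrite /= divr_ge0 ?mdist_ge0.
Qed.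

Lemma lipnorm_lip f x y : `|f x - f y| <= lipnorm f * mdist x y.
Proof.
have [->|xy] := eqVneq x y; first by rewrite subrr normr0 mdistxx mulr0.
rewrite -ler_pdivrMr ?mdist_gt0//; apply: ub_le_sup.
  exact: slopes_has_ubound.
by exists (x, y).
Qed.

Lemma lipnorm_le f (k : R) : 0 <= k ->
  (forall x y, `|f x - f y| <= k * mdist x y) -> lipnorm f <= k.
Proof.
move=> k0 fk; have [s0|/set0P s0] := eqVneq (slopes f) set0.
  by rewrite /lipnorm s0 sup0.
apply: ge_sup => // _ [[x y] /= xy <-].
by rewrite ler_pdivrMr ?mdist_gt0.
Qed.

Lemma lipnormD f g : lipnorm (f + g) <= lipnorm f + lipnorm g.
Proof.
apply: lipnorm_le => [|x y]; first by rewrite addr_ge0 ?lipnorm_ge0.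
rewrite !lip0_addE opprD addrACA (le_trans (ler_normD _ _))// mulrDl.
by rewrite lerD ?lipnorm_lip.
Qed.

Lemma lipnormZ (a : R) f : lipnorm (a *: f) = `|a| * lipnorm f.
Proof.
have le b g : lipnorm (b *: g) <= `|b| * lipnorm g.
  apply: lipnorm_le => [|x y]; first by rewrite mulr_ge0 ?lipnorm_ge0.
  by rewrite !lip0_scaleE -mulrBr normrM -mulrA ler_wpM2l ?lipnorm_lip.
apply/eqP; rewrite eq_le le/=.
have [->|a0] := eqVneq a 0; first by rewrite normr0 mul0r lipnorm_ge0.
have := le a^-1 (a *: f); rewrite scalerA mulVf// scale1r normfV.
by rewrite mulrC ler_pdivlMr ?normr_gt0// mulrC.
Qed.

Lemma lipnorm_eq0 f : lipnorm f = 0 -> f = 0.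
Proof.
move=> f0; apply: lip0_eqP => x; have := lipnorm_lip f x p.
by rewrite f0 mul0r lip0_base subr0 normr_le0 => /eqP.
Qed.

HB.instance Definition _ := @Lmodule_isNormed.Build R (lip0 p) lipnorm
  lipnormD lipnormZ lipnorm_eq0.

End lip0_norm.

Section lip0_complete.
Context {R : realType} {T : metricType R} {p : T}.

Lemma lip0_complete (F : set_system (lip0 p)) :
  ProperFilter F -> cauchy F -> cvg F.
Proof.
move=> FF /cauchyP Fc.
have {}Fc (e : R) : 0 < e -> exists f : lip0 p, \forall g \near F, `|f - g| < e.
  move=> e0; have [f] := Fc e e0; rewrite -ball_normE => ff.
  by exists f.
have ev (h : lip0 p) x : `|h x| <= `|h| * mdist x p.
  by have := lipnorm_lip h x p; rewrite lip0_base subr0.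
have cx x : cvg ((fun f : lip0 p => f x : R) @ F).
  apply: cauchy_cvg; apply/cauchyP => e e0.
  have d0 : 0 < mdist x p + 1 by rewrite ltr_wpDl ?mdist_ge0.
  have [f Ff] := Fc (e / (mdist x p + 1)) (divr_gt0 e0 d0).
  exists (f x); change (\forall h \near F, ball (f x) e ((h : lip0 p) x)).
  near=> h; rewrite -ball_normE /ball_/=.
  rewrite (le_lt_trans (ev (f - h) x))//.
  rewrite (@le_lt_trans _ _ (`|f - h| * (mdist x p + 1)))//.
    by rewrite ler_wpM2l// lerDl.
  by rewrite -ltr_pdivlMr//; near: h.
pose g x : R := lim ((fun f : lip0 p => f x : R) @ F).
have lime (e : R) (f : lip0 p) : (\forall h \near F, `|f - h| < e) ->
    forall x y, `|(f x - g x) - (f y - g y)| <= e * mdist x y.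
  move=> Ff x y.
  have cv : (fun h : lip0 p => `|(f x - h x) - (f y - h y)|) @ F -->
      `|(f x - g x) - (f y - g y)|.
    apply: cvg_norm; apply: cvgB.
      by apply: cvgB; [exact: cvg_cst|exact: cx].
    by apply: cvgB; [exact: cvg_cst|exact: cx].
  have ccv : cvg ((fun h : lip0 p => `|(f x - h x) - (f y - h y)|) @ F).
    by apply/cvg_ex; eexists; exact: cv.
  rewrite -(cvg_lim _ cv)//; apply: limr_le => //; near=> h.
  rewrite (le_trans (lipnorm_lip (f - h) x y))//.
  by rewrite ler_wpM2r ?mdist_ge0// ltW//; near: h.
have gl : g \in lip0_pred p.
  rewrite inE; split.
    rewrite /g (_ : (fun f : lip0 p => _) = fun=> 0) ?lim_cst//.
    by apply/funext => f; exact: lip0_base.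
  have [f Ff] := Fc 1 ltr01; exists (`|f| + 1) => x y.
  rewrite (_ : g x - g y = (f x - f y) - ((f x - g x) - (f y - g y))).
    rewrite (le_trans (ler_normB _ _))// mulrDl lerD//; first exact: lipnorm_lip.
    exact: lime.
  rewrite -[LHS](subKr (f x - f y)); congr (_ - _).
  by rewrite !opprD addrACA.
apply/cvg_ex; exists (Lip0 gl); apply/cvgrPdist_le => e e0.
have e20 : 0 < e / 2 by rewrite divr_gt0.
have [f Ff] := Fc _ e20; near=> h.
rewrite -(subrKA f) (le_trans (ler_normD _ _))// [leRHS]splitr lerD//.
  rewrite distrC; apply: lipnorm_le; first exact: ltW.
  exact: lime.
by rewrite ltW//; near: h.
Unshelve. all: by end_near. Qed.

HB.instance Definition _ := Uniform_isComplete.Build (lip0 p) lip0_complete.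

End lip0_complete.

(* Main.v *)
(** If [M] is convex, a rank-one operator [f |-> phi f *: w] is tested on a
   nearly norming [f] of norm at most 1. Along a segment where [w] has slope almost
   [`|w|] there are many short, well separated pieces where it is still steep;
   adding to [f] a bump at one end of a piece makes [f] as steep as possible
   there, keeping its Lipschitz constant at most [1 + e]. The bumps have disjoint
   supports, so their sum is Lipschitz with a constant independent of their
   number, and adding one of them hardly lowers [phi f].

   If [M] is not convex, some segment joins two points [x], [y] of [M] outside
   [M], and by strict convexity no third point of [M] lies metrically between
   [x] and [y]. By compactness there is [g] whose slopes are close to 1 only at
   pairs close to [(x, y)]; for the operator
   [f |-> ((f y - f x) / |x - y|) *: g] the slopes of [f] and of its image then
   nearly cancel at those pairs, and the Daugavet equation fails. *)
Require Import Defs.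
From HB Require Import structures.
From mathcomp Require Import all_boot all_order all_algebra.
From mathcomp Require Import all_classical all_reals all_analysis.
From mathcomp Require Import lra ring.

Set Implicit Arguments.
Unset Strict Implicit.
Unset Printing Implicit Defensive.

Import Order.TTheory GRing.Theory Num.Theory.
Import numFieldNormedType.Exports.

Local Open Scope classical_set_scope.
Local Open Scope ring_scope.

(** * Operator norms and rank-one operators *)

Section opnorm.
Context {R : realType} {Z W : normedModType R}.
Implicit Types (T : Z -> W) (k : R) (z : Z).

Lemma opnorm_le T k : (forall z, `|z| <= 1 -> `|T z| <= k) -> opnorm T <= k.
Proof.
move=> Tk; apply: ge_sup; last by move=> _ [z /= z1 <-]; exact: Tk.
by exists `|T 0|; exists 0 => //=; rewrite normr0.
Qed.

(** The bound by [k] keeps the supremum away from its default value 0. Linearity is not bundled, so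
    that the lemma also applies to [fun f => S f + f]. *)
Lemma le_opnorm1 T k z : (forall z, `|T z| <= k * `|z|) -> `|z| <= 1 ->
  `|T z| <= opnorm T.
Proof.
move=> Tk z1; apply: ub_le_sup; last by exists z.
exists `|k| => _ [t /= t1 <-]; rewrite (le_trans (Tk t))//.
rewrite (le_trans (ler_norm _))// normrM normr_id.
by rewrite -[leRHS]mulr1 ler_wpM2l.
Qed.

Lemma le_opnorm T k z : (forall z, `|T z| <= k * `|z|) ->
  (forall (a : R) z, T (a *: z) = a *: T z) -> `|T z| <= opnorm T * `|z|.
Proof.
move=> Tk TZ; have [->|z0] := eqVneq z 0.
  by rewrite -(scale0r 0) TZ !scale0r !normr0 mulr0.
rewrite -ler_pdivrMr ?normr_gt0// mulrC -(ger0_norm (_ : 0 <= `|z|^-1))//.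
  rewrite -normrZ -TZ; apply: le_opnorm1 Tk _.
  by rewrite normrZ normfV normr_id mulVf ?normr_eq0.
Qed.

Lemma bounded_linear_bound (T : {linear Z -> W}) : bounded_near T (nbhs 0) ->
  exists k, forall z, `|T z| <= k * `|z|.
Proof.
by move=> /linear_boundedP /pinfty_ex_gt0[k _ Tk]; exists k.
Qed.

Lemma linear_bound_bounded (T : {linear Z -> W}) k :
  (forall z, `|T z| <= k * `|z|) -> bounded_near T (nbhs 0).
Proof.
move=> Tk; apply/linear_boundedP; near=> r => z.
rewrite (le_trans (Tk z))// ler_wpM2r//.
Unshelve. all: by end_near. Qed.

(** Since [w] is nonzero, the coefficient of [w] in [T z] is unique; this makes the chosen [phi]
    linear. *)
Lemma rank_oneP (T : {linear Z -> W}) : rank_one T ->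
  exists2 w : W, w != 0 & exists phi : Z -> R,
    (forall z, T z = phi z *: w) /\
    (forall a u v, phi (a *: u + v) = a * phi u + phi v).
Proof.
move=> [w w0 Tw]; exists w => //.
have /choice[phi phiE] : forall z, exists a, T z = a *: w.
  move=> z; have : range T (T z) by exists z.
  by rewrite Tw => -[a _ <-]; exists a.
exists phi; split=> // a u v; apply/eqP; rewrite -subr_eq0.
have := scaler_eq0 (phi (a *: u + v) - (a * phi u + phi v)) w.
rewrite (negbTE w0) orbF => <-; rewrite scalerBl scalerDl.
by rewrite -scalerA -!phiE linearP subrr eqxx.
Qed.

End opnorm.

(** * Lipschitz functions and sums with disjoint supports *)

Section lip0_theory.
Context {R : realType} {T : metricType R} {p : T}.
Implicit Types (f g : lip0 p) (x y : T).

Lemma ler_lip0 f x y : f x - f y <= `|f| * mdist x y.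
Proof. by rewrite (le_trans (ler_norm _)) ?lipnorm_lip. Qed.

Lemma lip0_norm_le f (k : R) : 0 <= k ->
  (forall x y, f x - f y <= k * mdist x y) -> `|f| <= k.
Proof.
move=> k0 fk; apply: lipnorm_le => // x y.
by rewrite ler_norml fk lerNl opprB metric_sym fk.
Qed.

(** Functions can thus be built without regard to the base point, since the shift changes no
    difference of values. *)
Lemma lip0_base_shift (f : T -> R) (k : R) :
  (forall x y, f x - f y <= k * mdist x y) ->
  exists F : lip0 p, forall x, F x = f x - f p.
Proof.
move=> fk; suff Fp : (fun x => f x - f p) \in lip0_pred p by exists (Lip0 Fp).
rewrite inE; split; first by rewrite subrr.
exists k => x y; rewrite opprB subrKA.
by rewrite ler_norml fk lerNl opprB metric_sym fk.
Qed.

Lemma lip0_lt_norm f (r : R) : r < `|f| -> 0 <= r ->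
  exists x y, r * mdist x y < f x - f y.
Proof.
move=> rf r0; apply: contrapT => nex; move: rf; rewrite ltNge => /negP; apply.
apply: lip0_norm_le => // x y; rewrite leNgt; apply/negP => xy.
by apply: nex; exists x, y.
Qed.

Lemma lip0_sumE (I : Type) (r : seq I) (F : I -> lip0 p) x :
  (\sum_(i <- r) F i) x = \sum_(i <- r) F i x.
Proof.
by elim/big_ind2: _ => // f1 a1 f2 a2 <- <-.
Qed.

End lip0_theory.

(** At most one term is positive at [x], and the other terms at [y] only lower the difference. The
    bound is therefore that of a single [h i], whatever the number of terms. *)
Lemma sum_disjoint_le {R : realDomainType} (I : finType) (T : Type)
    (h : I -> T -> R) (x y : T) (b : R) : 0 <= b ->
  (forall i z, 0 <= h i z) ->
  (forall i j z, 0 < h i z -> 0 < h j z -> i = j) ->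
  (forall i, h i x - h i y <= b) ->
  \sum_i h i x - \sum_i h i y <= b.
Proof.
move=> b0 h0 hdisj hb.
have [/existsP[i hix]|/existsPn none] := boolP [exists i, 0 < h i x].
  rewrite (bigD1 i)//= big1 ?addr0; last first.
    move=> j ji; apply: le_anti; rewrite h0 andbT leNgt.
    by apply: contra ji => hjx; rewrite (hdisj _ _ _ hjx hix).
  rewrite (le_trans _ (hb i))// lerB// (bigD1 i)//= lerDl.
  by rewrite sumr_ge0.
rewrite big1 => [|i _]; last by apply: le_anti; rewrite h0 andbT leNgt none.
by rewrite sub0r (le_trans _ b0)// oppr_le0 sumr_ge0.
Qed.

(** * Steepening a function by disjoint bumps *)

Section bumps.
Context {R : realType} {T : metricType R} {p : T}.

(* Each bump is the positive part of a cone of slope [1 + e] minus [f]; the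
   cone is steeper than [f], so the bump lives on a ball of radius comparable
   to the distance [d]. *)
Lemma exists_bumps (f : lip0 p) (e d : R) (n : nat) (u v : 'I_n -> T) :
  `|f| <= 1 -> 0 < e -> 0 < d ->
  (forall i, mdist (u i) (v i) = d) ->
  (forall i j, i != j -> 2 * (2 + e) / e * d <= mdist (u i) (u j)) ->
  exists h : 'I_n -> lip0 p,
    [/\ forall i, `|f + h i| <= 1 + e,
        forall i, (f + h i) (u i) - (f + h i) (v i) = (1 + e) * d &
        `|\sum_i h i| <= 2 + e].
Proof.
move=> f1 e0 d0 uv usep.
have f_lip x y : f x - f y <= mdist x y.
  by rewrite (le_trans (ler_lip0 f x y))// ler_piMl ?mdist_ge0.
(* The height of the apex makes the cone equal to [f (u i) + d] at [v i]. This is at least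
   [f (v i)], so the cone is not below [f] at either end of the pair. *)
pose c i x := f (u i) + (2 + e) * d - (1 + e) * mdist x (u i).
have clip i x y : c i x - c i y <= (1 + e) * mdist x y.
  have := metric_triangle y x (u i); rewrite /c (metric_sym y x).
  rewrite -(ler_pM2l (_ : 0 < 1 + e)); lra.
pose h i x := Num.max 0 (c i x - f x).
have hlip i x y : h i x - h i y <= (2 + e) * mdist x y.
  rewrite lerBlDr /h ge_max; have d1 := mdist_ge0 x y.
  have ed := mulr_ge0 (ltW e0) d1; apply/andP; split.
    have : 0 <= Num.max 0 (c i y - f y) by rewrite le_max lexx.
    lra.
  have : c i y - f y <= Num.max 0 (c i y - f y) by rewrite le_max lexx orbT.
  have := clip i x y; have := f_lip y x; rewrite (metric_sym y x); lra.
have fhlip i x y : (f x + h i x) - (f y + h i y) <= (1 + e) * mdist x y.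
  rewrite lerBlDr -lerBrDl /h ge_max; have d1 := mdist_ge0 x y.
  have ed := mulr_ge0 (ltW e0) d1; apply/andP; split.
    have : 0 <= Num.max 0 (c i y - f y) by rewrite le_max lexx.
    have := f_lip x y; lra.
  have : c i y - f y <= Num.max 0 (c i y - f y) by rewrite le_max lexx orbT.
  have := clip i x y; lra.
have h0 i x : 0 <= h i x by rewrite /h le_max lexx.
(* The bump lives within [(2 + e) / e * d] of [u i]; the separation assumed is twice this radius. *)
have hsupp i x : 0 < h i x -> e * mdist x (u i) < (2 + e) * d.
  rewrite /h lt_max ltxx/= subr_gt0 /c.
  have := f_lip (u i) x; rewrite (metric_sym (u i) x); lra.
have hdisj i j x : 0 < h i x -> 0 < h j x -> i = j.
  move=> /hsupp xi /hsupp xj; apply/eqP; apply: contraT => /usep.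
  rewrite mulrAC ler_pdivrMr//; have := metric_triangle (u i) x (u j).
  rewrite (metric_sym (u i) x) -(ler_pM2l e0); lra.
have /choice[H HE] i := @lip0_base_shift _ _ p _ _ (hlip i).
exists H; split=> [i|i|].
- apply: lip0_norm_le => [|x y]; first by lra.
  by rewrite !lip0_addE !HE !addrA opprB subrKA fhlip.
- have ed := mulr_gt0 e0 d0.
  have hu : h i (u i) = (2 + e) * d.
    by rewrite /h /c mdistxx max_r; [ring|lra].
  have hv : h i (v i) = f (u i) + d - f (v i).
    rewrite /h /c (metric_sym (v i)) uv max_r; first by ring.
    by have := f_lip (v i) (u i); rewrite (metric_sym (v i)) uv; lra.
  by rewrite !lip0_addE !HE hu hv; ring.
- apply: lip0_norm_le => [|x y]; first by lra.
  rewrite !lip0_sumE; under eq_bigr do rewrite HE.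
  under [X in _ - X]eq_bigr do rewrite HE.
  rewrite !sumrB opprB subrKA.
  apply: sum_disjoint_le => //.
  by rewrite mulr_ge0 ?mdist_ge0//; lra.
Qed.

End bumps.

(** * The Daugavet property over geodesic spaces *)

Section geodesic.
Context {R : realType} {T : metricType R}.

(** [gamma] is constrained only on the unit interval, where it runs at constant speed. *)
Definition geodesic_space : Prop := forall a b : T, exists gamma : R -> T,
  [/\ gamma 0 = a, gamma 1 = b & forall s t, 0 <= s -> s <= t -> t <= 1 ->
    mdist (gamma s) (gamma t) = (t - s) * mdist a b].

Context {p : T}.

(* If the slope of [w] along a geodesic is nearly [`|w|], then so is its slope
   along every piece that is not too short. *)
Lemma geodesic_slope (w : lip0 p) (gamma : R -> T) (a b : T) (e s t : R) :
  gamma 0 = a -> gamma 1 = b ->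
  (forall s t, 0 <= s -> s <= t -> t <= 1 ->
    mdist (gamma s) (gamma t) = (t - s) * mdist a b) ->
  `|w| * (1 - e) * mdist a b <= w a - w b -> 0 <= s -> s <= t -> t <= 1 ->
  `|w| * (t - s - e) * mdist a b <= w (gamma s) - w (gamma t).
Proof.
move=> g0 g1 gd wab s0 st t1.
have := ler_lip0 w (gamma 0) (gamma s); rewrite gd ?(le_trans st)// g0.
have := ler_lip0 w (gamma t) (gamma 1); rewrite gd ?(le_trans s0)// g1.
lra.
Qed.

(** Cut a nearly norming geodesic into [n] equal parts and keep an initial piece of each, shorter by
    the factor [K]. A relative loss of slope [e / (n * K)] on the whole geodesic is a loss of at
    most [e] on such a piece. *)
Lemma exists_steep_pieces (w : lip0 p) (e K : R) (n : nat) :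
  geodesic_space -> w != 0 -> 0 < e -> 1 <= K -> (0 < n)%N ->
  exists d (u v : 'I_n -> T), [/\ 0 < d, forall i, mdist (u i) (v i) = d,
    forall i j, i != j -> K * d <= mdist (u i) (u j) &
    forall i, `|w| * (1 - e) * d <= w (u i) - w (v i)].
Proof.
move=> geo w0 e0 K1 n0; pose m : R := n%:R.
have m1 : 1 <= m by rewrite ler1n.
have mK0 : 0 < (m * K)^-1 by rewrite invr_gt0 mulr_gt0//; lra.
have w_gt0 : 0 < `|w| by rewrite normr_gt0.
(* The factor is negative when [e] exceeds [m * K], while [lip0_lt_norm] asks for a nonnegative
   slope; hence the maximum with 0. *)
have [a [b ab]] : exists a b,
    Num.max 0 (`|w| * (1 - e * (m * K)^-1)) * mdist a b < w a - w b.
  apply: lip0_lt_norm; last by rewrite le_max lexx.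
  by rewrite gt_max w_gt0/= gtr_pMr// ltrBlDr ltrDl mulr_gt0.
have D0 : 0 < mdist a b.
  rewrite mdist_gt0; apply/eqP => E; move: ab.
  by rewrite E mdistxx mulr0 subrr ltxx.
have {}ab : `|w| * (1 - e * (m * K)^-1) * mdist a b <= w a - w b.
  rewrite (le_trans _ (ltW ab))// ler_wpM2r ?mdist_ge0//.
  by rewrite le_max lexx orbT.
have [gamma [g0 g1 gd]] := geo a b.
have mKE : m^-1 = K * (m * K)^-1 by field; apply/andP; split; lra.
pose r := (m * K)^-1; rewrite -/r in mK0 ab mKE.
have rm : r <= m^-1 by rewrite mKE ler_peMl// ltW.
have im (i : 'I_n) : 0 <= i%:R * m^-1 /\ i%:R * m^-1 + m^-1 <= 1.
  split; first by rewrite mulr_ge0// invr_ge0; lra.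
  rewrite -[X in _ + X]mul1r -mulrDl ler_pdivrMr; last by lra.
  by rewrite mul1r natr1 ler_nat.
exists (r * mdist a b), (fun i => gamma (i%:R * m^-1)),
  (fun i => gamma (i%:R * m^-1 + r)).
split=> [|i|i j ij|i].
- exact: mulr_gt0.
- by have [i0 i1] := im i; rewrite gd//; [congr (_ * _); ring|lra|lra].
- wlog {ij} ij : i j / (i < j)%N => [H|].
    have [/H//|/H|/val_inj E] := ltngtP i j; first by rewrite [leRHS]metric_sym.
    by rewrite E eqxx in ij.
  have [i0 i1] := im i; have [j0 j1] := im j.
  have ijm : i%:R * m^-1 + m^-1 <= j%:R * m^-1 :> R.
    by rewrite -[X in _ + X]mul1r -mulrDl natr1 ler_wpM2r ?ler_nat// invr_ge0; lra.
  have im0 : 0 <= m^-1 by rewrite invr_ge0; lra.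
  rewrite gd//; [|lra|lra].
  by rewrite mulrA -mKE ler_wpM2r ?mdist_ge0//; lra.
- have [i0 i1] := im i.
  have := geodesic_slope (s := i%:R * m^-1) (t := i%:R * m^-1 + r) g0 g1 gd ab.
  move=> /(_ i0); rewrite lerDl => /(_ (ltW mK0)) H.
  have ir1 : i%:R * m^-1 + r <= 1 by lra.
  apply: le_trans (H ir1).
  by rewrite le_eqVlt; apply/orP; left; apply/eqP; ring.
Qed.

Lemma geodesic_daugavet : geodesic_space ->
  daugavet_property (lip0 p : completeNormedModType R).
Proof.
move=> geo S Sbnd S1.
have [k Sk] := bounded_linear_bound Sbnd.
have [w w0 [phi [SE phiL]]] := rank_oneP S1.
have w_gt0 : 0 < `|w| by rewrite normr_gt0.
pose N := opnorm S.
have SN f : `|S f| <= N * `|f|.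
  by apply: le_opnorm Sk _ => a z; rewrite linearZ.
have IS f : `|S f + f| <= (k + 1) * `|f|.
  by rewrite (le_trans (ler_normD _ _))// mulrDl mul1r lerD.
have phiD f g : phi (f + g) = phi f + phi g.
  by have := phiL 1 f g; rewrite scale1r mul1r.
have phi0 : phi 0 = 0 by have := phiD 0 0; rewrite addr0; lra.
have phiN f : phi (- f) = - phi f.
  by have := phiD f (- f); rewrite subrr phi0; lra.
have phi_sum (I : finType) (F : I -> lip0 p) :
    phi (\sum_i F i) = \sum_i phi (F i).
  by apply: (big_morph phi phiD phi0).
have phiw f : `|phi f| * `|w| <= N * `|f| by rewrite -normrZ -SE.
have N0 : 0 <= N.
  rewrite (le_trans (normr_ge0 (S 0)))//; apply: le_opnorm1 Sk _.
  by rewrite normr0.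
apply: le_anti; apply/andP; split.
  apply: opnorm_le => f f1; rewrite (le_trans (ler_normD _ _))// addrC lerD//.
  by rewrite (le_trans (SN f))// ler_piMr.
(* The slope found below is at least [1 + N - e - 2 * e * N], for a function of norm up to [1 + e];
   that norm costs at most a further [e * (1 + N)]. *)
suff main (e : R) : 0 < e -> e < 1 ->
    1 + N - e * (2 + 3 * N) <= opnorm (fun f => S f + f).
  apply/ler_addgt0Pr => eta eta0; rewrite -lerBlDr.
  have d0 : 0 < 2 + 3 * N by lra.
  pose e := Num.min (1 / 2) (eta / (2 + 3 * N)).
  have e0 : 0 < e by rewrite lt_min divr_gt0//= divr_gt0.
  have e1 : e < 1 by rewrite gt_min; apply/orP; left; lra.
  rewrite (le_trans _ (main _ e0 e1))// lerB//.
  by rewrite -ler_pdivlMr// ge_min lexx orbT.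
move=> e0 e1.
have [f f1 fN] : exists2 f : lip0 p, `|f| <= 1 & N - e <= phi f * `|w|.
  have Ssup : has_sup [set `|S z| | z in [set z : lip0 p | `|z| <= 1]].
    split; first by exists `|S 0|; exists 0 => //=; rewrite normr0.
    by exists N => _ [z /= z1 <-]; rewrite (le_trans (SN z))// ler_piMr.
  have [_ [f /= f1 <-]] := sup_adherent e0 Ssup.
  rewrite -/(opnorm S) -/N SE normrZ => fN.
  have [pf|pf] := leP 0 (phi f).
    by exists f => //; rewrite ltW// -(ger0_norm pf).
  by exists (- f); rewrite ?normrN// phiN ltW// -(ltr0_norm pf).
(* If every bump lowered [phi f * |w|] by more than [e], their sum would lower it by more than
   [3 * N]. But the sum has norm at most [2 + e <= 3]. *)
pose n := (Num.truncn (3 * N / e)).+1.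
have nN : 3 * N < n%:R * e by rewrite -ltr_pdivrMr// truncnS_gt.
have K1 : 1 <= 2 * (2 + e) / e by rewrite ler_pdivlMr//; lra.
have n0 : (0 < n)%N by [].
have [d [u [v [d0 uv usep wuv]]]] := exists_steep_pieces geo w0 e0 K1 n0.
have [h [h1 h2 h3]] := exists_bumps f1 e0 d0 uv usep.
have [i hi] : exists i, - e <= phi (h i) * `|w|.
  apply: contrapT => nex.
  have small i : phi (h i) * `|w| <= - e.
    by rewrite leNgt; apply/negP => /ltW hi; apply: nex; exists i.
  have : \sum_(i < n) phi (h i) * `|w| <= \sum_(i < n) - e by apply: ler_sum.
  rewrite -mulr_suml -phi_sum sumr_const card_ord -mulr_natr => sume.
  have := ler_wpM2l N0 h3; have := phiw (\sum_i h i).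
  have := ler_wpM2r (ltW w_gt0) (ler_norm (- phi (\sum_i h i))); rewrite normrN.
  have := ler_wpM2l N0 (ltW e1); lra.
pose F := f + h i.
have FN : N - 2 * e <= phi F * `|w| by rewrite phiD mulrDl; lra.
have qN : phi F * `|w| <= 2 * N.
  rewrite (le_trans (ler_wpM2r _ (ler_norm _)))// (le_trans (phiw _))//.
  by rewrite mulrC ler_wpM2r// (le_trans (h1 i))//; lra.
have slope : (1 + e + N - 2 * e - 2 * e * N) * d <=
    (S F + F) (u i) - (S F + F) (v i).
  have -> : (S F + F) (u i) - (S F + F) (v i) =
      phi F * (w (u i) - w (v i)) + (F (u i) - F (v i)).
    by rewrite SE !lip0_addE !lip0_scaleE; ring.
  rewrite h2.
  have wle := ler_lip0 w (u i) (v i); rewrite uv in wle.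
  suff : phi F * `|w| * d - 2 * N * e * d <= phi F * (w (u i) - w (v i)).
    by have := ler_wpM2r (ltW d0) FN; lra.
  (* For negative [phi F] the estimate follows from the Lipschitz bound on [w] alone; steepness of
     the piece serves the other case. *)
  have [pF|pF] := leP 0 (phi F).
    have := ler_wpM2l pF (wuv i).
    have := ler_wpM2r (ltW (mulr_gt0 e0 d0)) qN; lra.
  have := ler_wnM2l (ltW pF) wle.
  have := mulr_ge0 N0 (ltW (mulr_gt0 e0 d0)); lra.
have := le_trans slope (ler_lip0 _ _ _); rewrite uv ler_pM2r// => SF.
pose P := opnorm (fun f => S f + f); rewrite -/P.
have : `|S F + F| <= P * `|F|.
  apply: (le_opnorm (T := fun f => S f + f)) => // a z.
  by rewrite linearZ scalerDr.
have P0 : 0 <= P.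
  rewrite (le_trans (normr_ge0 (S 0 + 0)))//.
  by apply: (le_opnorm1 (T := fun f => S f + f) IS); rewrite normr0.
have := ler_wpM2l P0 (h1 i); rewrite -/F leNgt => PF SFP; apply/negP => Plt.
have : P * e <= (1 + N) * e.
  by rewrite ler_pM2r//; have := mulr_ge0 N0 (ltW e0); lra.
lra.
Qed.

End geodesic.

(** * Failure of the Daugavet property at an isolated pair *)

Section isolated_pair.
Context {R : realType} {T : metricType R} {p : T}.

(* The cone [h1] at [x] is kept only on the ball around [x]. Off both balls it
   lies below the cone [h2] at [y], so only pairs joining the two balls can see
   a slope above [1 - tau]. *)
Lemma exists_peak (x y : T) (tau : R) (D := mdist x y)
    (del := D / 8) : x != y -> 0 < tau -> tau <= 1 / 2 ->
  (forall z, del <= mdist z x -> del <= mdist z y ->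
    D <= (1 - tau) * (mdist z x + mdist z y)) ->
  exists g : lip0 p,
  [/\ `|g| <= 1, (1 - tau / 4) * D <= g x - g y &
    forall u v, (1 - tau) * mdist u v < g u - g v ->
      mdist u x < del /\ mdist v y < del].
Proof.
move=> xy tau0 tau2 far.
have D0 : 0 < D by rewrite mdist_gt0.
have delE : del = D / 8 by [].
(* The peak is [D - 2 * tau * del]: the two cones have slope [1 - tau], and this lowering keeps
   slopes between the two balls at most 1. *)
pose h1 z := (1 - 2 * tau / 8) * D - (1 - tau) * mdist z x.
pose h2 z := (1 - tau) * mdist z y.
pose g z := if mdist z x < del then Num.max (h1 z) (h2 z) else h2 z.
have t0 : 0 <= 1 - tau by lra.
have h1lip u v : h1 u - h1 v <= (1 - tau) * mdist u v.
  have := ler_wpM2l t0 (metric_triangle v u x).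
  by rewrite /h1 (metric_sym v u); lra.
have h2lip u v : h2 u - h2 v <= (1 - tau) * mdist u v.
  by have := ler_wpM2l t0 (metric_triangle u v y); rewrite /h2; lra.
have tD : 0 < tau * D by apply: mulr_gt0.
have g2 z : h2 z <= g z.
  by rewrite /g; case: ifP => // _; rewrite le_max lexx orbT.
have g1 z : del <= mdist z y -> h1 z <= g z.
  move=> zy; rewrite /g; case: ltP => zx; first by rewrite le_max lexx.
  by have := far z zx zy; rewrite /h1 /h2; lra.
have glip u v : (1 - tau) * mdist u v < g u - g v ->
    [/\ mdist u x < del, mdist v y < del & g u - g v <= mdist u v].
  (* As [h2 <= g] and [h2] has slope at most [1 - tau], a steep pair cannot start where [g] equals
     [h2]. *)
  move=> uv; have u2 : g u <> h2 u.
    by move=> E; have := h2lip u v; have := g2 v; lra.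
  have ux : mdist u x < del.
    by move: u2; rewrite {1}/g; case: ifP.
  have gu : g u = h1 u.
    by move: u2; rewrite /g ux; case: (leP (h1 u) (h2 u)).
  have vy : mdist v y < del.
    rewrite ltNge; apply/negP => /g1 gv.
    by have := h1lip u v; lra.
  split=> //; have := g2 v; rewrite gu /h1 /h2.
  have := metric_triangle x u y; have := metric_triangle u v y.
  rewrite -/D (metric_sym x u).
  have := ler_wpM2l (ltW tau0) (ltW ux); have := ler_wpM2l (ltW tau0) (ltW vy).
  rewrite delE; lra.
have glip1 u v : g u - g v <= 1 * mdist u v.
  rewrite mul1r; have [H|/glip[]//] := leP (g u - g v) ((1 - tau) * mdist u v).
  by rewrite (le_trans H)// ler_piMl ?mdist_ge0//; lra.
have [G GE] := @lip0_base_shift _ _ p _ _ glip1.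
have GB u v : G u - G v = g u - g v by rewrite !GE opprB subrKA.
exists G; split=> [||u v].
- by apply: lip0_norm_le => // u v; rewrite GB.
- rewrite GB; have del0 : 0 < del by rewrite delE divr_gt0.
  have -> : g y = 0.
    rewrite /g /h2 mdistxx mulr0 (metric_sym y) -/D ifF//.
    by apply/negbTE; rewrite -leNgt delE; lra.
  rewrite /g mdistxx del0 subr0 le_max /h1 mdistxx; apply/orP; left; lra.
- by rewrite GB => /glip[].
Qed.

(** The operator [f |-> m f *: g] has norm at least [1 - tau / 4], but adding the identity gives
    norm at most [2 - tau], which is less than [2 - tau / 4]. *)
Lemma isolated_pair_not_daugavet (x y : T) (tau : R) (D := mdist x y)
    (del := D / 8) : x != y -> 0 < tau -> tau <= 1 / 2 ->
  (forall z, del <= mdist z x -> del <= mdist z y ->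
    D <= (1 - tau) * (mdist z x + mdist z y)) ->
  ~ daugavet_property (lip0 p : completeNormedModType R).
Proof.
move=> xy tau0 tau2 far.
have D0 : 0 < D by rewrite mdist_gt0.
have delE : del = D / 8 by [].
have [g [g1 gxy gpeak]] := exists_peak xy tau0 tau2 far.
have gN : 1 - tau / 4 <= `|g|.
  by rewrite -(ler_pM2r D0) (le_trans gxy)// ler_lip0.
have g0 : g != 0 by rewrite -normr_gt0; lra.
pose m (f : lip0 p) := (f y - f x) / D.
have m1 f : `|m f| <= `|f|.
  rewrite /m normrM normfV (gtr0_norm D0) ler_pdivrMr//.
  by rewrite (le_trans (lipnorm_lip f y x))// metric_sym.
pose S0 (f : lip0 p) := m f *: g.
have Slin : linear S0.
  move=> a u v; rewrite /S0 scalerA -scalerDl; congr (_ *: _).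
  by rewrite /m !lip0_addE !lip0_scaleE; ring.
pose S : {linear lip0 p -> lip0 p} :=
  HB.pack S0 (GRing.isLinear.Build _ _ _ _ S0 Slin).
have SE f : S f = m f *: g by [].
have Sk f : `|S f| <= 1 * `|f|.
  by rewrite SE normrZ mul1r (le_trans _ (m1 f))// ler_piMr.
(* The distance to [x] has norm at most 1 and [m f0 = 1] up to the sign of the pair's orientation
   being built into [m]; it shows that [S] reaches all multiples of [g] and has norm at least
   [|g|]. *)
have [f0 f0E] : exists F : lip0 p, forall z, F z = mdist z x - mdist p x.
  apply: (@lip0_base_shift _ _ p (fun z => mdist z x) 1) => u v.
  by rewrite mul1r lerBlDr metric_triangle.
have f01 : `|f0| <= 1.
  apply: lip0_norm_le => // u v.
  by rewrite !f0E opprB subrKA mul1r lerBlDr metric_triangle.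
have mf0 : m f0 = 1.
  by rewrite /m !f0E opprB subrKA mdistxx subr0 metric_sym divff ?gt_eqF.
have Srank : rank_one S.
  exists g => //; apply/seteqP; split=> [_ [f _ <-]|_ [a _ <-]].
    by exists (m f).
  by exists (a *: f0) => //; rewrite linearZ SE mf0 scale1r.
move=> /(_ S (linear_bound_bounded Sk) Srank).
have gS : `|g| <= opnorm S.
  by have := le_opnorm1 Sk f01; rewrite SE mf0 scale1r.
suff : opnorm (fun f => S f + f) <= 2 - tau by move=> H E; lra.
apply: opnorm_le => f f1; apply: lip0_norm_le => [|u v]; first by lra.
have {}m1 := le_trans (m1 f) f1.
have fle a b : f a - f b <= mdist a b.
  by rewrite (le_trans (ler_lip0 f a b))// ler_piMl ?mdist_ge0.
have gle a b : g a - g b <= mdist a b.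
  by rewrite (le_trans (ler_lip0 g a b))// ler_piMl ?mdist_ge0.
have mle (c d : R) : `|c| <= d -> `|m f * c| <= d.
  by move=> cd; rewrite normrM (le_trans _ cd)// ler_piMl.
(* Near the pair, [f a - f b] almost cancels [m f * (g a - g b)]. *)
have peak a b : (1 - tau) * mdist a b < g a - g b ->
    `|m f * (g a - g b) + (f a - f b)| <= (2 - tau) * mdist a b.
  move=> ab; have [] := gpeak _ _ ab; rewrite -/D => ax by_.
  have mD : m f * D = f y - f x by rewrite /m divfK ?gt_eqF.
  have := fle y b; have := fle b y; rewrite (metric_sym y b).
  have := fle a x; have := fle x a; rewrite (metric_sym x a) => xa ax' by' yb.
  have := metric_triangle x a y; have := metric_triangle a b y.
  have := metric_triangle a x b; have := metric_triangle x y b.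
  rewrite (metric_sym y b) (metric_sym x a) -/D => t1 t2 t3 t4.
  (* The errors are [tau * mdist a b], then [D / 4] here and [D / 4] from moving [f] to the pair.
     They fit because [mdist a b >= 3 / 4 * D] and [tau <= 1 / 2]. *)
  have /mle : `|(g a - g b) - mdist a b| <= tau * mdist a b.
    by rewrite ler_norml; have := gle a b; lra.
  have /mle : `|mdist a b - D| <= D / 4 by rewrite ler_norml; lra.
  rewrite !ler_norml => /andP[p1 p2] /andP[p3 p4].
  have := ler_wpM2r (mdist_ge0 a b) tau2.
  by lra.
have -> : (S f + f) u - (S f + f) v = m f * (g u - g v) + (f u - f v).
  by rewrite SE !lip0_addE !lip0_scaleE; ring.
(* Both orientations are tested, since [m f] may have either sign. *)
have [uv|/peak] := leP (g u - g v) ((1 - tau) * mdist u v); last first.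
  by rewrite ler_norml => /andP[].
have [vu|/peak] := leP (g v - g u) ((1 - tau) * mdist v u); last first.
  by rewrite (metric_sym v u) ler_norml => /andP[]; lra.
have /mle : `|g u - g v| <= (1 - tau) * mdist u v.
  by rewrite ler_norml uv lerNl opprB metric_sym vu.
by rewrite ler_norml => /andP[_]; have := fle u v; lra.
Qed.

End isolated_pair.

(** * Gaps, segments and strict convexity *)

Lemma closed_gap {R : realType} (P : set R) (a b c : R) : closed P ->
  P a -> P b -> ~ P c -> a <= c -> c <= b ->
  exists s t, [/\ a <= s, t <= b, s < t, P s & P t] /\
    forall r, s < r -> r < t -> ~ P r.
Proof.
move=> Pcl Pa Pb Pc ac cb.
have cid : continuous (idfun : R -> R) by move=> ?; exact: cvg_id.
(* [s] is the last point of [P] up to [c], and [t] below is the first one from [c] on. *)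
have [|||s] := @compact_EVT_max _ R idfun (`[a, c] `&` P).
- by exists a; split=> //=; rewrite in_itv/= lexx.
- by apply: compact_closedI => //; exact: segment_compact.
- exact: continuous_subspaceT.
rewrite inE => -[/= + Ps] smax; rewrite in_itv/= => /andP[as_ sc].
have [|||t] := @compact_EVT_min _ R idfun (`[c, b] `&` P).
- by exists b; split=> //=; rewrite in_itv/= lexx andbT.
- by apply: compact_closedI => //; exact: segment_compact.
- exact: continuous_subspaceT.
rewrite inE => -[/= + Pt] tmin; rewrite in_itv/= => /andP[ct tb].
have {}sc : s < c by rewrite lt_neqAle sc andbT; apply/eqP => E; rewrite -E in Pc.
have {}ct : c < t by rewrite lt_neqAle ct andbT; apply/eqP => E; rewrite E in Pc.
exists s, t; split; first by split=> //; exact: lt_trans ct.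
move=> r sr rt Pr; have [rc|cr] := leP r c.
  have := smax r; rewrite inE/= in_itv/= rc (le_trans as_ (ltW sr))/=.
  by move=> /(_ (conj isT Pr)); rewrite leNgt sr.
have := tmin r; rewrite inE/= in_itv/= (ltW cr) (le_trans (ltW rt) tb)/=.
by move=> /(_ (conj isT Pr)); rewrite leNgt rt.
Qed.

Section normed.
Context {R : realType} {X : normedModType R}.
Implicit Types (x y z : X) (M : set X).

Lemma convex_setP M : convex_set M <->
  forall x y (t : R), M x -> M y -> 0 <= t -> t <= 1 -> M (x + t *: (y - x)).
Proof.
have convE x y (t : R) : x + t *: (y - x) = t *: y + (1 - t) *: x.
  by rewrite scalerBr scalerBl scale1r addrCA.
split=> [cM x y t Mx My t0 t1|cM x y t].
  by have := cM y x (Itv01 t0 t1); rewrite !inE convE => /(_ My Mx).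
rewrite !inE => Mx My.
by have H := cM y x t%:num My Mx (ge0 _) (le1 _); rewrite convE in H; exact: H.
Qed.

Lemma dist_line x y (s t : R) :
  `|(x + s *: (y - x)) - (x + t *: (y - x))| = `|t - s| * `|x - y|.
Proof.
rewrite opprD addrACA subrr add0r -scalerBl normrZ distrC.
by rewrite [X in _ * X]distrC.
Qed.

Lemma convex_geodesic M : convex_set M -> @geodesic_space R M.
Proof.
move=> /convex_setP cM a b.
pose l (t : R) := val a + t *: (val b - val a).
have /choice[gamma gammaE] t : exists c : M, 0 <= t <= 1 -> val c = l t.
  have [/andP[t0 t1]|_] := boolP (0 <= t <= 1); last by exists a.
  have Ml : M (l t) by apply: cM => //; exact: set_valP.
  by exists (exist _ (l t) (mem_set Ml)).
exists gamma; split.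
- by apply: val_inj; rewrite gammaE ?lexx ?ler01// /l scale0r addr0.
- by apply: val_inj; rewrite gammaE ?lexx ?ler01// /l scale1r addrC subrK.
- move=> s t s0 st t1; rewrite /mdist/= !gammaE ?s0 ?(le_trans st) ?(le_trans s0)//.
  by rewrite dist_line ger0_norm// subr_ge0.
Qed.

(* Equality in the triangle inequality forces the unit vectors along [z - x]
   and [y - z] to span a segment of the unit sphere. *)
Lemma strictly_convex_segment x y z : strictly_convex X ->
  `|z - x| + `|z - y| <= `|x - y| ->
  exists2 r, 0 <= r <= 1 & z = x + r *: (y - x).
Proof.
move=> hX; rewrite (distrC z y) (distrC x y).
have [->|zx] := eqVneq z x.
  by exists 0; rewrite ?lexx ?ler01// scale0r addr0.
have [->|zy] := eqVneq z y.
  by exists 1; rewrite ?lexx ?ler01// scale1r addrC subrK.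
set A := `|z - x|; set B := `|y - z| => xy.
have A0 : 0 < A by rewrite normr_gt0 subr_eq0.
have B0 : 0 < B by rewrite normr_gt0 subr_eq0 eq_sym.
pose u := A^-1 *: (z - x); pose v := B^-1 *: (y - z).
have Au : A *: u = z - x by rewrite scalerA divff ?gt_eqF// scale1r.
have Bv : B *: v = y - z by rewrite scalerA divff ?gt_eqF// scale1r.
have u1 : `|u| = 1 by rewrite normrZ normfV ger0_norm ?ltW// mulVf ?gt_eqF.
have v1 : `|v| = 1 by rewrite normrZ normfV ger0_norm ?ltW// mulVf ?gt_eqF.
clearbody u v.
have xyE : y - x = A *: u + B *: v by rewrite Au Bv [RHS]addrC subrKA.
have uv : u = v.
  apply: hX => t /andP[t0 t1]; apply: le_anti; apply/andP; split.
    rewrite (le_trans (ler_normD _ _))// !normrZ u1 v1 !ger0_norm ?subr_ge0//.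
    by lra.
  (* With this [c], taking [c] times the convex combination away from [A *: u + B *: v] leaves
     nonnegative coefficients of sum [A + B - c]. So the combination must have norm at least 1. *)
  pose c := Num.min A B.
  have c0 : 0 < c by rewrite lt_min A0.
  have cA : c <= A by rewrite ge_min lexx.
  have cB : c <= B by rewrite ge_min lexx orbT.
  have ctA : 0 <= A - c * (1 - t) by nra.
  have ctB : 0 <= B - c * t by nra.
  have : y - x = c *: ((1 - t) *: u + t *: v) +
      ((A - c * (1 - t)) *: u + (B - c * t) *: v).
    by rewrite xyE scalerDr !scalerA addrACA -!scalerDl !subrKC.
  move=> /(congr1 Num.norm) yxE; rewrite -(ler_pM2l c0).
  have := ler_normD (c *: ((1 - t) *: u + t *: v))
    ((A - c * (1 - t)) *: u + (B - c * t) *: v).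
  have := ler_normD ((A - c * (1 - t)) *: u) ((B - c * t) *: v).
  rewrite -yxE !normrZ u1 v1 (ger0_norm ctA) (ger0_norm ctB) (gtr0_norm c0).
  by lra.
exists (A / (A + B)).
  have AB : 0 < A + B by rewrite addr_gt0.
  by rewrite ltW ?divr_gt0//= ler_pdivrMr// mul1r lerDl ltW.
rewrite xyE -uv -scalerDl scalerA divfK ?gt_eqF ?addr_gt0// Au.
by rewrite addrC subrK.
Qed.

(** The pair bounds a gap of [M] on a segment. By strict convexity a third point giving equality
    would lie on the segment, inside the gap. *)
Lemma nonconvex_isolated_pair M : strictly_convex X -> closed M ->
  ~ convex_set M ->
  exists x y, [/\ M x, M y, x != y & forall z, M z -> z != x -> z != y ->
    `|x - y| < `|z - x| + `|z - y|].
Proof.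
move=> hX Mcl /convex_setP.
move=> /existsNP[a] /existsNP[b] /existsNP[c].
move=> /not_implyP[Ma] /not_implyP[Mb] /not_implyP[c0] /not_implyP[c1] Mc.
pose l (t : R) := a + t *: (b - a).
have lcont : continuous l.
  by move=> t; apply: cvgD; [exact: cvg_cst|apply: cvgZr_tmp; exact: cvg_id].
have [s [t [[s0 t1 st Ms Mt] gap]]] : exists s t,
    [/\ 0 <= s, t <= 1, s < t, M (l s) & M (l t)] /\
    forall r, s < r -> r < t -> ~ M (l r).
  apply: (@closed_gap _ (l @^-1` M) 0 1 c) => //.
  - by apply: preimage_closed => // ? _; exact: lcont.
  - by rewrite /= /l scale0r addr0.
  - by rewrite /= /l scale1r addrC subrK.
have lE r : l s + r *: (l t - l s) = l (s + r * (t - s)).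
  have -> : l t - l s = (t - s) *: (b - a).
    by rewrite /l opprD addrACA subrr add0r -scalerBl.
  by rewrite scalerA /l -addrA -scalerDl.
have ab : a != b by apply: contra_notN Mc => /eqP->; rewrite subrr scaler0 addr0.
exists (l s), (l t); split=> //.
  rewrite -subr_eq0 -normr_gt0 dist_line mulr_gt0 ?normr_gt0 ?subr_eq0//.
  by rewrite gt_eqF.
move=> z Mz zs zt; rewrite ltNge; apply/negP.
move=> /(strictly_convex_segment hX)[r /andP[r0 r1] zE].
have {}r0 : 0 < r.
  rewrite lt_neqAle r0 andbT; apply: contraNneq zs => r_0.
  by rewrite zE -r_0 scale0r addr0.
have {}r1 : r < 1.
  rewrite lt_neqAle r1 andbT; apply: contraNneq zt => r_1.
  by rewrite zE r_1 scale1r addrC subrK.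
apply: (gap (s + r * (t - s))); [nra|nra|by rewrite -lE -zE].
Qed.

(** By compactness the sum of distances has a minimum [mu] over the far points, and [mu] exceeds the
    distance of the pair; this makes the strict inequality uniform. *)
Lemma compact_far_points M x y (del : R) : compact M -> 0 < del ->
  (forall z, M z -> z != x -> z != y -> `|x - y| < `|z - x| + `|z - y|) ->
  exists tau, [/\ 0 < tau, tau <= 1 / 2 & forall z, M z ->
    del <= `|z - x| -> del <= `|z - y| ->
    `|x - y| <= (1 - tau) * (`|z - x| + `|z - y|)].
Proof.
move=> Mco del0 far.
pose K := M `&` ([set z | del <= `|z - x|] `&` [set z | del <= `|z - y|]).
have ncont w : continuous (fun z : X => `|z - w|).
  by move=> z; apply: cvg_norm; apply: cvgB; [exact: cvg_id|exact: cvg_cst].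
have ncl w : closed [set z : X | del <= `|z - w|].
  apply: (@preimage_closed _ _ (fun z : X => `|z - w|) [set r | del <= r]).
    by move=> ? _; exact: ncont.
  exact: closed_ge.
have [K0|/set0P K0] := eqVneq K set0.
  exists (1 / 2); split; [lra|lra|move=> z Mz zx zy].
  by have : K z by []; rewrite K0.
have [||c] := @compact_EVT_min _ R (fun z => `|z - x| + `|z - y|) K K0.
- by apply: compact_closedI => //; exact: closedI.
- by apply: continuous_subspaceT => z; apply: cvgD; exact: ncont.
rewrite inE => -[Mc [/= cx cy]] cmin.
set mu := `|c - x| + `|c - y| in cmin.
have Dmu : `|x - y| < mu.
  by apply: far => //; rewrite -subr_eq0 -normr_gt0; lra.
have mu0 : 0 < mu by rewrite (le_lt_trans _ Dmu).
pose tau := Num.min (1 / 2) (1 - `|x - y| / mu).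
exists tau; split.
- by rewrite lt_min divr_gt0//= subr_gt0 ltr_pdivrMr// mul1r.
- by rewrite ge_min lexx.
move=> z Mz zx zy; have muz : mu <= `|z - x| + `|z - y|.
  by apply: cmin; rewrite inE.
have : tau <= 1 - `|x - y| / mu by rewrite ge_min lexx orbT.
have : tau <= 1 / 2 by rewrite ge_min lexx.
move=> tau2 taumu; rewrite (@le_trans _ _ ((1 - tau) * mu))//.
  by rewrite -ler_pdivrMr//; lra.
by rewrite ler_wpM2l//; lra.
Qed.

End normed.

(** * Compact subsets of strictly convex spaces *)

Theorem mainTheorem5 (R : realType) (X : completeNormedModType R) (M : set X)
    (p : M) (hX : strictly_convex X) (hMinf : infinite_set M)
    (hMcpt : compact M) :
  daugavet_property (lip0 p : completeNormedModType R) <-> convex_set M.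
Proof.
split=> [|cM]; last exact: geodesic_daugavet (convex_geodesic cM).
apply: contraPP => ncM.
have Mcl : closed M by apply: compact_closed => //; exact: norm_hausdorff.
have [x [y [Mx My xy far]]] := nonconvex_isolated_pair hX Mcl ncM.
have d0 : 0 < `|x - y| / 8 by rewrite divr_gt0// normr_gt0 subr_eq0.
have [tau [tau0 tau2 tauP]] := compact_far_points hMcpt d0 far.
pose x' : M := exist _ x (mem_set Mx); pose y' : M := exist _ y (mem_set My).
apply: (@isolated_pair_not_daugavet _ _ p x' y' tau) => // z zx zy.
by apply: tauP => //; exact: set_valP.
Qed.
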